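(* Let $F \in \mathcal{S}_d$ be a (nonzero) form of local cactus rank at most $d$. Then $F$ has at most $d^n$ minimal local apolar schemes.
   Context: Let $n \ge 1$ be an integer, $\Bbbk$ a field whose characteristic is zero or strictly larger than $d$, $\mathcal{S} = \bigoplus_d \mathcal{S}_d = \Bbbk[x_0,\dots,x_n]$ and $\mathcal{R} = \Bbbk[y_0,\dots,y_n]$ with standard gradings. The ring $\mathcal{R}$ acts on $\mathcal{S}$ by derivation: $\Bbbk$-bilinearly, $y^\beta \circ x^\alpha = \frac{\alpha!}{(\alpha-\beta)!}x^{\alpha-\beta}$ if $\alpha \ge \beta$ componentwise and $0$ otherwise. For $F \in \mathcal{S}_d$, $\mathrm{Ann}^{\circ}(F) = \{G \in \mathcal{R} : G \circ F = 0\}$. A zero-dimensional scheme $\mathcal{Z} \subset \mathbb{P}^n(\Bbbk) = \mathrm{Proj}\,\mathcal{R}$, with saturated homogeneous ideal $I(\mathcal{Z}) \subset \mathcal{R}$, is apolar to $F$ if $I(\mathcal{Z}) \subseteq \mathrm{Ann}^{\circ}(F)$. It is local if it is supported at a single point. All schemes considered are assumed to have $\Bbbk$-rational support. The local cactus rank of $F$ is the minimal length of a local zero-dimensional scheme apolar to $F$. A minimal local apolar scheme of $F$ is a local scheme apolar to $F$ whose length equals the local cactus rank of $F$. *)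

(* Defs.v *)
From HB Require Import structures.
From mathcomp Require Import all_boot all_order all_algebra.
From mathcomp Require Import boolp classical_sets functions cardinality.
From mathcomp.multinomials Require Import mpoly.

Set Implicit Arguments.
Unset Strict Implicit.
Unset Printing Implicit Defensive.

Import GRing.Theory.

Local Open Scope ring_scope.
Local Open Scope classical_set_scope.

(* A single type {mpoly k[n.+1]} plays the role both of S = k[x_0, ..., x_n]
   (arguments F) and of R = k[y_0, ..., y_n] (arguments G, I, P). *)

Section Apolarity.
Variables (n : nat) (k : fieldType).
Local Notation R := {mpoly k[n.+1]}.

(* F^`M[b] is the iterated formal partial derivative, so that
   'X_[a]^`M[b] = (a! / (a - b)!) 'X_[a - b], and 0 unless b <= a. *)
Definition apply_diff (G F : R) : R :=
  \sum_(b <- msupp G) G@_b *: F^`M[b].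

Definition Ann (F : R) : set R := [set G | apply_diff G F = 0].

End Apolarity.

Section Schemes.
Variables (n : nat) (k : fieldType).
Local Notation R := {mpoly k[n.+1]}.

Definition is_ideal (I : set R) : Prop :=
  [/\ I 0, forall f g, I f -> I g -> I (f + g) & forall f g, I g -> I (f * g)].

Definition is_homogeneous (I : set R) : Prop :=
  forall f, I f -> forall e, I (pihomog mdeg e f).

(* Saturation with respect to the irrelevant ideal m = (y_0, ..., y_n):
   if m^e f is contained in I for some e, then f is in I. *)
Definition is_saturated (I : set R) : Prop :=
  forall f e, (forall b : 'X_{1..n.+1}, mdeg b = e -> I ('X_[b] * f)) -> I f.

(* Closed subschemes Z of P^n = Proj R are represented by their saturated
   homogeneous ideals I(Z); the unit ideal corresponds to the empty scheme. *)
Definition is_scheme_ideal (I : set R) : Prop :=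
  [/\ is_ideal I, is_homogeneous I & is_saturated I].

Definition hilbert_function_at (I : set R) (e h : nat) : Prop :=
  exists2 V : {vspace dhomog n.+1 k e},
    (forall f : dhomog n.+1 k e, f \in V <-> I (val f)) &
    (\dim V + h)%N = \dim {:dhomog n.+1 k e}.

(* The Hilbert polynomial of R / I is the constant r. This says that the
   scheme has dimension at most 0 and length r; r = 0 is the empty scheme. *)
Definition has_length (I : set R) (r : nat) : Prop :=
  exists e0, forall e, (e0 <= e)%N -> hilbert_function_at I e r.

Definition is_prime_ideal (P : set R) : Prop :=
  [/\ is_ideal P, ~ P 1 & forall f g, P (f * g) -> P f \/ P g].

Definition Proj : set (set R) :=
  [set P | [/\ is_prime_ideal P, is_homogeneous P & exists i, ~ P 'X_i]].

Definition scheme_support (I : set R) : set (set R) := Proj `&` [set P | I `<=` P].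

(* Homogeneous ideal of the point [v_0 : ... : v_n]. Homogeneous components are
   evaluated separately, since k may be finite. *)
Definition point_ideal (v : 'I_n.+1 -> k) : set R :=
  [set f | forall e, (pihomog mdeg e f).@[v] = 0].

Definition has_rational_support (I : set R) : Prop :=
  forall P, scheme_support I P ->
    exists2 v : 'I_n.+1 -> k, (exists i, v i != 0) & P = point_ideal v.

Definition is_local (I : set R) : Prop := exists P, scheme_support I = [set P].

Definition local_scheme_of_length (I : set R) (r : nat) : Prop :=
  [/\ is_scheme_ideal I, has_length I r, has_rational_support I & is_local I].

End Schemes.

Section LocalCactusRank.
Variables (n : nat) (k : fieldType).
Local Notation R := {mpoly k[n.+1]}.

Definition is_apolar (F : R) (I : set R) : Prop := I `<=` Ann F.

Definition local_apolar_of_length (F : R) (I : set R) (r : nat) : Prop :=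
  local_scheme_of_length I r /\ is_apolar F I.

Definition is_local_cactus_rank (F : R) (r : nat) : Prop :=
  (exists I, local_apolar_of_length F I r) /\
  (forall I s, local_apolar_of_length F I s -> (r <= s)%N).

Definition minimal_local_apolar (F : R) : set (set R) :=
  [set I | exists2 r, is_local_cactus_rank F r & local_apolar_of_length F I r].

End LocalCactusRank.

(* Main.v *)
Require Import Defs.
From HB Require Import structures.
From mathcomp Require Import all_boot all_order all_algebra.
From mathcomp Require Import boolp classical_sets functions cardinality.
From mathcomp Require Import zify ring.
From mathcomp.multinomials Require Import ssrcomplements mpoly.

(* Let I be a local scheme of length r <= d at the point v, apolar to F, and put
   u_i = y_i - v_i y_j where v_j = 1. In a local algebra of length r every
   product of r elements of the maximal ideal vanishes, so I contains all
   products of r of the u_i. This has two consequences.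
   - F is killed by every product of d derivations u_i, hence vanishes on the
     hyperplane v_0 x_0 + ... + v_n x_n = 0. Thus the points that occur are
     linear factors of F, and there are at most d <= d^n of them.
   - If I and I' are minimal at the same v, the saturation K of I + I' agrees
     with I + I' in degree d, since both contain all products of d + 1 of the
     u_i; hence K is again apolar to F, and minimality forces I = K = I'. *)

Set Implicit Arguments.
Unset Strict Implicit.
Unset Printing Implicit Defensive.

Import GRing.Theory.

Local Open Scope ring_scope.
Local Open Scope classical_set_scope.
Local Open Scope card_scope.

(** * Induction principles and homogeneous components of polynomials *)

Section Polynomials.
Variables (n : nat) (k : fieldType).
Local Notation R := {mpoly k[n]}.

Lemma mpoly_lin_ind (Q : R -> Prop) :
  Q 0 -> (forall f g, Q f -> Q g -> Q (f + g)) ->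
  (forall c f, Q f -> Q (c *: f)) -> (forall b, Q 'X_[b]) -> forall f, Q f.
Proof.
move=> Q0 QD QZ QX f; rewrite [f]mpolyE.
by elim/big_ind: _ => // b _; apply/QZ/QX.
Qed.

Lemma homog_lin_ind (Q : R -> Prop) e :
  Q 0 -> (forall f g, Q f -> Q g -> Q (f + g)) ->
  (forall c f, Q f -> Q (c *: f)) ->
  (forall b, mdeg b = e -> Q 'X_[b]) -> forall f, f \is e.-homog -> Q f.
Proof.
move=> Q0 QD QZ QX f hf; rewrite [f]mpolyE big_seq.
by elim/big_ind: _ => // b /(dhomog_mf hf) hb; apply/QZ/QX.
Qed.

Lemma mnm_rect (Q : 'X_{1..n} -> Prop) :
  Q 0%MM -> (forall i b, Q b -> Q (U_(i) + b)%MM) -> forall b, Q b.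
Proof.
move=> Q0 QS b; move: {2}(mdeg b) (erefl (mdeg b)) => m.
elim: m b => [|m IH] b hb; first by move/eqP: hb; rewrite mdeg_eq0 => /eqP ->.
have [i bi] : exists i, b i != 0%N.
  apply/existsP; apply: contraT; rewrite negb_exists => /forallP h.
  suff: b == 0%MM by rewrite -mdeg_eq0 hb.
  by apply/eqP/mnmP => i; move: (h i); rewrite negbK mnm0E => /eqP.
have le : (U_(i) <= b)%MM by rewrite lep1mP.
have eb : b = (U_(i) + (b - U_(i)))%MM by rewrite addmC submK.
rewrite eb; apply/QS/IH.
by move: hb; rewrite {1}eb mdegD mdeg1 add1n => -[].
Qed.

Lemma mpoly_alg_ind (Q : R -> Prop) :
  (forall c, Q c%:MP) -> (forall i, Q 'X_i) ->
  (forall f g, Q f -> Q g -> Q (f + g)) ->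
  (forall f g, Q f -> Q g -> Q (f * g)) -> forall f, Q f.
Proof.
move=> QC QX QD QM; apply: mpoly_lin_ind => //.
- by rewrite -mpolyC0; apply: QC.
- by move=> c f Qf; rewrite -mul_mpolyC; apply: QM.
- elim/mnm_rect => [|i b Qb]; first by rewrite mpolyX0; apply: QC.
  by rewrite mpolyXD; apply: QM.
Qed.

Lemma pihomogM e (f g : R) :
  pihomog mdeg e (f * g) =
  \sum_(i < e.+1) pihomog mdeg i f * pihomog mdeg (e - i)%N g.
Proof.
elim/mpoly_lin_ind: f => [|f1 f2 IH1 IH2|c f IH|a].
- by rewrite mul0r linear0 big1 // => i _; rewrite linear0 mul0r.
- rewrite mulrDl pihomogD IH1 IH2 -big_split /=; apply: eq_bigr => i _.
  by rewrite pihomogD mulrDl.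
- rewrite -scalerAl linearZ /= IH scaler_sumr; apply: eq_bigr => i _.
  by rewrite linearZ /= -scalerAl.
elim/mpoly_lin_ind: g => [|g1 g2 IH1 IH2|c g IH|b].
- by rewrite mulr0 linear0 big1 // => i _; rewrite linear0 mulr0.
- rewrite mulrDr pihomogD IH1 IH2 -big_split /=; apply: eq_bigr => i _.
  by rewrite pihomogD mulrDr.
- rewrite -scalerAr linearZ /= IH scaler_sumr; apply: eq_bigr => i _.
  by rewrite linearZ /= -scalerAr.
rewrite -mpolyXD pihomogX /= mdegD; case: eqP => [he|he].
  have lt : (mdeg a < e.+1)%N by rewrite ltnS -he leq_addr.
  have hb : (e - mdeg a)%N = mdeg b by rewrite -he addKn.
  rewrite (bigD1 (Ordinal lt)) //= !pihomogX eqxx hb eqxx mpolyXD.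
  rewrite big1 ?addr0 // => i; rewrite -val_eqE /= eq_sym => /negbTE ni.
  by rewrite pihomogX ni mul0r.
rewrite big1 // => i _; rewrite !pihomogX; case: eqP => [hi|]; rewrite ?mul0r //.
case: eqP => [hj|]; rewrite ?mulr0 //.
by case: he; rewrite hi hj subnKC // -ltnS.
Qed.

Lemma pihomogMl m e (h f : R) : h \is m.-homog ->
  pihomog mdeg (m + e)%N (h * f) = h * pihomog mdeg e f.
Proof.
move=> hh; rewrite pihomogM.
have lt : (m < (m + e).+1)%N by rewrite ltnS leq_addr.
rewrite (bigD1 (Ordinal lt)) //= addKn pihomog_dE //.
rewrite big1 ?addr0 // => i; rewrite -val_eqE /= eq_sym => ni.
by rewrite (pihomog_ne0 ni hh) mul0r.
Qed.

Lemma dhomogXU (i : 'I_n) : ('X_i : R) \is 1.-homog.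
Proof. by rewrite dhomogX /= mdeg1. Qed.

Lemma dhomog_prodseq (T : eqType) (u : T -> R) (s : seq T) :
  (forall i, i \in s -> u i \is 1.-homog) -> \prod_(i <- s) u i \is (size s).-homog.
Proof.
elim: s => [|i s IH] hu; first by rewrite big_nil dhomog1.
rewrite big_cons -[size _]/(size s).+1 -add1n; apply: dhomogM.
  by apply: hu; rewrite mem_head.
by apply: IH => l ls; apply: hu; rewrite in_cons ls orbT.
Qed.

End Polynomials.

(** * The action of polynomials by differentiation *)

Section Differentiation.
Variables (n : nat) (k : fieldType).
Local Notation R := {mpoly k[n.+1]}.

(** A range of summation that depends only on a degree bound can be shared by several polynomials,
    so that linearity in [G] is checked term by term. *)
Lemma apply_diffwE m (G F : R) : (msize G <= m)%N ->
  apply_diff G F = \sum_(b : 'X_{1..n.+1 < m}) G@_b *: F^`M[b].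
Proof.
move=> le_Gm; pose I : subFinType _ := 'X_{1..n.+1 < m}.
rewrite /apply_diff (big_mksub I) /=; first last.
- by move=> x /msize_mdeg_lt/leq_trans/(_ le_Gm).
- by rewrite msupp_uniq.
by rewrite big_rmcond //= => b /memN_msupp_eq0 ->; rewrite scale0r.
Qed.

Lemma apply_diff_linear (F : R) : linear (fun G : R => apply_diff G F).
Proof.
move=> c G H; pose m := maxn (msize (c *: G + H)) (maxn (msize G) (msize H)).
rewrite !(@apply_diffwE m) ?leq_max ?leqnn ?orbT //.
rewrite scaler_sumr -big_split /=; apply: eq_bigr => b _.
by rewrite mcoeffD mcoeffZ scalerDl scalerA.
Qed.

Lemma apply_diffD (G H F : R) :
  apply_diff (G + H) F = apply_diff G F + apply_diff H F.
Proof. by have := apply_diff_linear F 1 G H; rewrite !scale1r. Qed.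

Lemma apply_diff0 (F : R) : apply_diff 0 F = 0.
Proof. by rewrite /apply_diff msupp0 big_nil. Qed.

Lemma apply_diffZ c (G F : R) : apply_diff (c *: G) F = c *: apply_diff G F.
Proof. by have := apply_diff_linear F c G 0; rewrite apply_diff0 !addr0. Qed.

Lemma apply_diffX b (F : R) : apply_diff 'X_[b] F = F^`M[b].
Proof. by rewrite /apply_diff msuppX big_seq1 mcoeffX eqxx scale1r. Qed.

Lemma apply_diff_is_linear_r (G : R) : linear (apply_diff G).
Proof.
move=> c F H; rewrite /apply_diff scaler_sumr -big_split /=.
by apply: eq_bigr => b _; rewrite linearP scalerDr !scalerA mulrC.
Qed.

HB.instance Definition _ (G : R) :=
  GRing.isLinear.Build k R R _ (apply_diff G) (apply_diff_is_linear_r G).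

Lemma apply_diffM (G H F : R) :
  apply_diff (G * H) F = apply_diff G (apply_diff H F).
Proof.
elim/mpoly_lin_ind: G => [|f g IHf IHg|c f IH|a].
- by rewrite mul0r !apply_diff0.
- by rewrite mulrDl !apply_diffD IHf IHg.
- by rewrite -scalerAl !apply_diffZ IH.
elim/mpoly_lin_ind: H => [|f g IHf IHg|c f IH|b].
- by rewrite mulr0 !apply_diff0 linear0.
- by rewrite mulrDr !apply_diffD linearD /= IHf IHg.
- by rewrite -scalerAr !apply_diffZ linearZ /= IH.
by rewrite -mpolyXD !apply_diffX addmC mderivmDm.
Qed.

Lemma Ann_ideal (F : R) : is_ideal (Ann F).
Proof.
split; rewrite /Ann /=; first exact: apply_diff0.
- by move=> f g hf hg; rewrite apply_diffD hf hg addr0.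
- by move=> f g hg; rewrite apply_diffM hg linear0.
Qed.

Lemma apply_diff_homog d e (G F : R) :
  F \is (e + d).-homog -> G \is e.-homog -> apply_diff G F \is d.-homog.
Proof.
move=> hF; elim/homog_lin_ind => [|f g|c f|b hb].
- by rewrite apply_diff0 dhomog0.
- by rewrite apply_diffD; apply: dhomogD.
- by rewrite apply_diffZ; apply: dhomogZ.
rewrite apply_diffX; apply/dhomogP => b'.
rewrite mcoeff_msupp mcoeff_mderivm; apply: contraNeq => nb.
rewrite (dhomog_nemf_coeff hF) ?mul0rn //=.
by rewrite mdegD hb eqn_add2l.
Qed.

Lemma apply_diff_homog_gt d e (G F : R) :
  (d < e)%N -> F \is d.-homog -> G \is e.-homog -> apply_diff G F = 0.
Proof.
move=> lt hF; elim/homog_lin_ind => [|f g hf hg|c f hf|b hb].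
- exact: apply_diff0.
- by rewrite apply_diffD hf hg addr0.
- by rewrite apply_diffZ hf scaler0.
rewrite apply_diffX; apply/mpolyP => b'; rewrite mcoeff_mderivm mcoeff0.
rewrite (dhomog_nemf_coeff hF) ?mul0rn //=.
by rewrite mdegD hb gtn_eqF // ltn_addr.
Qed.

Lemma natr_fact_neq0 d m :
  (forall p, p \in [pchar k] -> (d < p)%N) -> (m <= d)%N -> (m`!)%:R != 0 :> k.
Proof.
move=> hp; elim: m => [|m IH] hm; first by rewrite oner_neq0.
rewrite factS natrM mulf_neq0 //; last by apply/IH/ltnW.
rewrite natf_neq0_pchar; apply/pnatP => // p _ pm; apply/negP => /hp.
by rewrite ltnNge (leq_trans (dvdn_leq _ pm)).
Qed.

Lemma homog_mderivm_eq0 d m (F : R) :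
  (forall p, p \in [pchar k] -> (d < p)%N) -> (m <= d)%N -> F \is m.-homog ->
  (forall b, mdeg b = m -> F^`M[b] = 0) -> F = 0.
Proof.
move=> hp hm hF F0; apply/mpolyP => b; rewrite mcoeff0.
case: (eqVneq (mdeg b) m) => [hb|]; last exact: dhomog_nemf_coeff.
have := congr1 (mcoeff 0%MM) (F0 b hb); rewrite mcoeff_mderivm mcoeff0 addm0.
move/eqP; rewrite -mulr_natr mulf_eq0 => /orP[/eqP //|/eqP].
rewrite natr_prod => /eqP /prodf_eq0 [i _]; rewrite ffactnn.
have bi : (b i <= d)%N.
  by apply: leq_trans hm; rewrite -hb mdegE (bigD1 i) //= leq_addr.
by rewrite (negbTE (natr_fact_neq0 hp bi)).
Qed.

(** The chain rule: it holds for constants and variables and is preserved by sums and, through the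
    Leibniz rule, by products. *)
Lemma mderiv_comp_mpoly (lq : n.+1.-tuple R) i (F : R) :
  (F \mPo lq)^`M(i) = \sum_l (F^`M(l) \mPo lq) * (tnth lq l)^`M(i).
Proof.
elim/mpoly_alg_ind: F => [c|a|f g IHf IHg|f g IHf IHg].
- rewrite comp_mpolyC mderivC big1 // => l _.
  by rewrite mderivC comp_mpoly0 mul0r.
- rewrite (bigD1 a) //= big1 => [|l la].
    rewrite comp_mpolyXU mderivX mnm1E eqxx -[X in (X - _)%MM]add0m addmK.
    by rewrite mpolyX0 scale1r comp_mpoly1 mul1r addr0 -tnth_nth.
  by rewrite mderivX mnm1E eq_sym (negbTE la) scale0r comp_mpoly0 mul0r.
- rewrite comp_mpolyD mderivD IHf IHg -big_split /=; apply: eq_bigr => l _.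
  by rewrite mderivD comp_mpolyD mulrDl.
rewrite rmorphM /= mderivM IHf IHg mulr_suml mulr_sumr -big_split /=.
apply: eq_bigr => l _; rewrite mderivM comp_mpolyD !rmorphM /= mulrDl mulrAC.
by rewrite -!mulrA.
Qed.

End Differentiation.

(** * Restriction to hyperplanes and linear factors *)

Section LinearFactors.
Variables (n : nat) (k : fieldType).
Local Notation R := {mpoly k[n.+1]}.
Implicit Types (v w : 'I_n.+1 -> k) (i j : 'I_n.+1).

Definition lform v : R := \sum_i v i *: 'X_i.

Definition uform v j i : R := 'X_i - v i *: 'X_j.

(* When v j = 1, this substitution is the projection onto the hyperplane
   lform v = 0 along the j-th axis. *)
Definition hyp_proj v j : n.+1.-tuple R :=
  [tuple 'X_l - (l == j)%:R *: lform v | l < n.+1].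

Lemma mcoeff_lform v i : (lform v)@_U_(i) = v i.
Proof.
rewrite raddf_sum (bigD1 i) //= mcoeffZ mcoeffXU eqxx mulr1 big1 ?addr0 // => l li.
by rewrite mcoeffZ mcoeffXU (negbTE li) mulr0.
Qed.

Lemma lform_homog v : lform v \is 1.-homog.
Proof. by rewrite rpred_sum // => i _; rewrite dhomogZ // dhomogXU. Qed.

Lemma msize_lform v j : v j = 1 -> msize (lform v) = 2.
Proof.
move=> vj; have L0 : lform v != 0.
  apply/eqP => L0; have := mcoeff_lform v j; rewrite L0 mcoeff0 vj => /esym/eqP.
  by rewrite oner_eq0.
have := dhomog_uniq L0 (lform_homog v) (dhomog_msize (lform_homog v)) => /=.
by move: L0; rewrite -msize_poly_eq0; case: (msize (lform v)) => [|m _ /= <-].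
Qed.

Lemma lform_hyp_proj v w j :
  lform v \mPo hyp_proj w j = lform (fun i => v i - v j * w i).
Proof.
have -> : lform v \mPo hyp_proj w j = lform v - v j *: lform w.
  rewrite /lform raddf_sum /= -/(lform w).
  under eq_bigr => i _ do
    rewrite comp_mpolyZ comp_mpolyXU -tnth_nth tnth_mktuple scalerBr.
  rewrite big_split /= sumrN; congr (_ - _); rewrite (bigD1 j) //= eqxx scale1r.
  by rewrite big1 ?addr0 // => i /negbTE ->; rewrite scale0r scaler0.
rewrite /lform scaler_sumr -sumrB; apply: eq_bigr => i _.
by rewrite scalerA -scalerBl.
Qed.

(** Used in contrapositive form: the linear form of one point does not vanish on the hyperplane of a
    different point. *)
Lemma lform_hyp_proj_eq0 v w j :
  lform v \mPo hyp_proj w j = 0 -> v = (fun i => v j * w i).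
Proof.
rewrite lform_hyp_proj => h; apply/funext => i; apply/eqP; rewrite -subr_eq0.
by rewrite -(mcoeff_lform (fun i => v i - v j * w i)) h mcoeff0.
Qed.

(** The substitution changes each variable by a multiple of [lform v], so it is the identity modulo
    [lform v]. Hence a polynomial that it sends to 0 is divisible by [lform v]. *)
Lemma hyp_projE v j (F : R) : exists G, F = F \mPo hyp_proj v j + lform v * G.
Proof.
elim/mpoly_alg_ind: F => [c|i|f g [f1 hf] [g1 hg]|f g [f1 hf] [g1 hg]].
- by exists 0; rewrite comp_mpolyC mulr0 addr0.
- exists (i == j)%:R%:MP; rewrite comp_mpolyXU -tnth_nth tnth_mktuple.
  by rewrite mulrC mul_mpolyC subrK.
- by exists (f1 + g1); rewrite comp_mpolyD {1}hf {1}hg mulrDr addrACA.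
- exists (f1 * g + (f \mPo hyp_proj v j) * g1); rewrite rmorphM /=.
  by rewrite {1}hf {1}hg {3}hg mulrDr !mulrDl mulrDr !mulrA; ring.
Qed.

(** In the chain rule only the directions i and j contribute: ['X_i] gives the partial derivative in
    direction i, and the term - [lform v] substituted along j gives - [v i] times the one in
    direction j. *)
Lemma mderiv_hyp_proj v j i (F : R) :
  (F \mPo hyp_proj v j)^`M(i) = apply_diff (uform v j i) F \mPo hyp_proj v j.
Proof.
have dX l : ('X_l : R)^`M(i) = (l == i)%:R%:MP.
  by rewrite mderivX mnm1E; case: eqP => [->|]; rewrite ?scale0r // scale1r
    -[X in (X - _)%MM]add0m addmK mpolyX0.
have dL : (lform v)^`M(i) = (v i)%:MP.
  rewrite /lform raddf_sum (bigD1 i) //= big1 => [|l /negbTE li].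
    by rewrite mderivZ dX eqxx -mul_mpolyC mulr1 addr0.
  by rewrite mderivZ dX li scaler0.
rewrite mderiv_comp_mpoly.
under eq_bigr => l _ do
  rewrite tnth_mktuple mderivB mderivZ dX dL mulrBr -scalerAr.
rewrite big_split /= sumrN (bigD1 i) //= eqxx mulr1 big1 => [|l /negbTE ->];
  last by rewrite mulr0.
rewrite (bigD1 j) //= eqxx scale1r big1 => [|l /negbTE ->];
  last by rewrite scale0r.
rewrite !addr0 /uform apply_diffD -scaleNr apply_diffZ !apply_diffX !mderivmU1m.
by rewrite comp_mpolyD comp_mpolyZ scaleNr mulrC mul_mpolyC.
Qed.

Lemma mderivm_hyp_proj v j b :
  exists2 s : seq 'I_n.+1, size s = mdeg b & forall F : R,
    (F \mPo hyp_proj v j)^`M[b] =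
    apply_diff (\prod_(i <- s) uform v j i) F \mPo hyp_proj v j.
Proof.
elim/mnm_rect: b => [|i b [s hs IH]].
  by exists [::] => [|F]; rewrite ?mdeg0 // big_nil -mpolyX0 apply_diffX !mderivm0m.
exists (i :: s) => [|F]; first by rewrite mdegD mdeg1 -hs.
by rewrite mderivmDm mderivmU1m mderiv_hyp_proj IH -apply_diffM big_cons mulrC.
Qed.

Lemma comp_homog d (lq : n.+1.-tuple R) (F : R) :
  (forall i, tnth lq i \is 1.-homog) -> F \is d.-homog -> F \mPo lq \is d.-homog.
Proof.
move=> hlq hF; move: d F hF => d F; elim/homog_lin_ind => [|f g|c f|b <-].
- by rewrite comp_mpoly0 dhomog0.
- by rewrite comp_mpolyD; apply: dhomogD.
- by rewrite comp_mpolyZ; apply: dhomogZ.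
elim/mnm_rect: b => [|i b IH]; first by rewrite mpolyX0 comp_mpoly1 mdeg0 dhomog1.
rewrite mpolyXD rmorphM /= mdegD mdeg1; apply: dhomogM => //.
by rewrite comp_mpolyXU -tnth_nth.
Qed.

(* A d-th order derivative of the restriction of F to the hyperplane is the
   restriction of a derivative of F along d directions of that hyperplane. *)
Lemma hyp_proj_eq0 d v j (F : R) :
  (forall p, p \in [pchar k] -> (d < p)%N) -> F \is d.-homog ->
  (forall s, size s = d -> apply_diff (\prod_(i <- s) uform v j i) F = 0) ->
  F \mPo hyp_proj v j = 0.
Proof.
move=> hp hF F0; apply: (homog_mderivm_eq0 hp (leqnn d)) => [|b hb].
  apply: comp_homog => // i; rewrite tnth_mktuple rpredB ?dhomogXU //.
  by rewrite dhomogZ // lform_homog.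
have [s hs ->] := mderivm_hyp_proj v j b.
by rewrite F0 ?comp_mpoly0 // hs.
Qed.

(** Induction strips off the factor [lform (v m)]. The cofactor still vanishes on the earlier
    hyperplanes, since [lform (v m)] does not and there are no zero divisors; its size is one
    less. *)
Lemma num_linear_factors (v : nat -> 'I_n.+1 -> k) (j : nat -> 'I_n.+1) m (F : R) :
  (forall a, (a < m)%N -> v a (j a) = 1) ->
  (forall a b, (a < b < m)%N -> lform (v b) \mPo hyp_proj (v a) (j a) != 0) ->
  F != 0 -> (forall a, (a < m)%N -> F \mPo hyp_proj (v a) (j a) = 0) ->
  (m < msize F)%N.
Proof.
elim: m F => [|m IH] F hv hnp F0 hF; first by rewrite lt0n msize_poly_eq0.
have [G hG] := hyp_projE (v m) (j m) F.
rewrite hF // add0r in hG.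
have G0 : G != 0 by apply: contraNneq F0 => G0; rewrite hG G0 mulr0.
have L0 : lform (v m) != 0.
  by apply: contraNneq F0 => L0; rewrite hG L0 mul0r.
rewrite hG msizeM // (msize_lform (hv m _)) //= ltnS; apply: IH => //.
- by move=> a am; apply/hv/ltnW.
- by move=> a b /andP[ab bm]; apply: hnp; rewrite ab ltnW.
move=> a am; have := hF a (ltnW am); rewrite hG rmorphM /= => /eqP.
by rewrite mulf_eq0 (negbTE (hnp _ _ _)) ?am //= => /eqP.
Qed.

End LinearFactors.

(** * Ideals and their Hilbert functions *)

Section Ideals.
Variables (n : nat) (k : fieldType).
Local Notation R := {mpoly k[n.+1]}.
Implicit Types (I K : set R) (f g : R).

Lemma ideal_mulr I f g : is_ideal I -> I f -> I (f * g).
Proof. by move=> [_ _ IM] If; rewrite mulrC; apply: IM. Qed.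

Lemma ideal_scale I c f : is_ideal I -> I f -> I (c *: f).
Proof. by move=> [_ _ IM] If; rewrite -mul_mpolyC; apply: IM. Qed.

Lemma ideal_sub I f g : is_ideal I -> I f -> I g -> I (f - g).
Proof.
move=> iI If Ig; have [_ ID _] := iI; apply: ID => //.
by rewrite -scaleN1r; apply: ideal_scale.
Qed.

Lemma ideal_subl I f g : is_ideal I -> I g -> I (f + g) -> I f.
Proof. by move=> iI Ig Ifg; rewrite -(addrK g f); apply: ideal_sub. Qed.

Lemma ideal_sum I (T : Type) (s : seq T) (P : pred T) (F : T -> R) :
  is_ideal I -> (forall i, P i -> I (F i)) -> I (\sum_(i <- s | P i) F i).
Proof. by move=> [I0 ID _] IF; elim/big_ind: _. Qed.

Lemma ideal_homog_components I f :
  is_ideal I -> (forall e, I (pihomog mdeg e f)) -> I f.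
Proof.
move=> iI If; rewrite [f](pihomog_partitionE (mf := mdeg) (leqnn _)).
exact: ideal_sum.
Qed.

Lemma prime_exp I f m : is_prime_ideal I -> I (f ^+ m) -> I f.
Proof.
move=> [_ I1 IP]; elim: m => [|m IH]; first by rewrite expr0.
by rewrite exprS => /IP[].
Qed.

Lemma mpoly_of_dhomog_lincomb e t (c : 'I_t -> k) (X : 'I_t -> dhomog n.+1 k e) :
  mpoly_of_dhomog (\sum_i c i *: X i) = \sum_i c i *: mpoly_of_dhomog (X i).
Proof. by rewrite raddf_sum. Qed.

(** Independence modulo [I] makes the span of the [w i] meet the degree [e] part of [I] trivially,
    so the two dimensions add up inside the space of all forms of degree [e]. *)
Lemma hilbert_indep_le I e h t (w : 'I_t -> R) :
  hilbert_function_at I e h -> I 0 -> (forall i, w i \is e.-homog) ->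
  (forall c : 'I_t -> k, I (\sum_i c i *: w i) -> forall i, c i = 0) -> (t <= h)%N.
Proof.
move=> [V IV dV] I0 hw ind.
pose X := [tuple DHomog (hw i) | i < t].
have valX (c : 'I_t -> k) :
    mpoly_of_dhomog (\sum_i c i *: X`_i) = \sum_i c i *: w i.
  rewrite mpoly_of_dhomog_lincomb; apply: eq_bigr => i _.
  by rewrite -tnth_nth tnth_mktuple.
have fX : free X.
  by apply/freeP => c hc; apply: ind; rewrite -valX hc raddf0.
have XV : (<<X>> :&: V = 0)%VS.
  apply/eqP; rewrite -subv0; apply/subvP => x; rewrite memv_cap => /andP[xX xV].
  rewrite (coord_span xX) memv0 big1 // => i _.
  move/IV: xV; rewrite /= {1}(coord_span xX) valX => /ind ->.
  by rewrite scale0r.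
have := dimvS (subvf (<<X>> + V)%VS).
rewrite dimv_disjoint_sum // -dV (eqP fX) size_tuple.
by rewrite addnC leq_add2l.
Qed.

Lemma hilbert_indep_ex I e h :
  hilbert_function_at I e h -> exists2 w : 'I_h -> R, forall i, w i \is e.-homog &
  forall c : 'I_h -> k, I (\sum_i c i *: w i) -> forall i, c i = 0.
Proof.
move=> [V IV dV].
have dC : \dim (V^C)%VS = h by rewrite dimv_compl -dV addKn.
rewrite -dC; pose X := vbasis (V^C)%VS.
exists (fun i => val X`_i) => [i|c hc]; first exact: dhomog_is_dhomog.
have xV : \sum_i c i *: X`_i \in V.
  by apply/IV; rewrite /= mpoly_of_dhomog_lincomb.
have xC : \sum_i c i *: X`_i \in (V^C)%VS.
  by apply: rpred_sum => i _; rewrite rpredZ // vbasis_mem // mem_nth ?size_tuple.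
move/freeP: (basis_free (vbasisP (V^C)%VS)) => fX; apply: fX.
by apply/eqP; rewrite -memv0 -(capv_compl V) memv_cap xV.
Qed.

(** A subspace of maximal dimension among those contained in [I] must be the whole degree [e] part,
    as adjoining a further element of [I] would enlarge it. *)
Lemma hilbert_exists I e : is_ideal I -> exists h, hilbert_function_at I e h.
Proof.
move=> iI; have [I0 ID _] := iI.
pose inI (V : {vspace dhomog n.+1 k e}) :=
    forall f : dhomog n.+1 k e, f \in V -> I (val f).
pose P m := `[< exists2 V, inI V & \dim V = m >].
have exP : exists m, P m.
  exists 0%N; apply/asboolP; exists 0%VS; last by rewrite dimv0.
  by move=> f; rewrite memv0 => /eqP ->.
have leP m : P m -> (m <= \dim {:dhomog n.+1 k e})%N.
  by move=> /asboolP[V _ <-]; rewrite dimvS // subvf.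
case: (ex_maxnP exP leP) => m /asboolP[V inV dV] maxm.
exists (\dim {:dhomog n.+1 k e} - m)%N, V; last first.
  by rewrite dV subnKC // leP //; apply/asboolP; exists V.
move=> f; split=> [/inV //|If].
have PV : P (\dim (V + <[f]>)).
  apply/asboolP; exists (V + <[f]>)%VS => // x.
  move=> /memv_addP[y yV [z /vlineP[c ->] ->]].
  by apply: ID; [exact: inV | exact: ideal_scale].
have /eqP -> : V == (V + <[f]>)%VS by rewrite eqEdim addvSl dV maxm.
by rewrite (subvP (addvSr _ _)) // memv_line.
Qed.

Lemma hilbert_le I K e h h' : I `<=` K ->
  hilbert_function_at I e h -> hilbert_function_at K e h' -> (h' <= h)%N.
Proof.
move=> IK [V IV dV] [W KW dW].
have VW : (V <= W)%VS by apply/subvP => f /IV/IK/KW.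
by rewrite -(leq_add2l (\dim W)) dW -dV leq_add2r dimvS.
Qed.

Lemma hilbert_eq_mem I K e h f : I `<=` K ->
  hilbert_function_at I e h -> hilbert_function_at K e h ->
  f \is e.-homog -> K f -> I f.
Proof.
move=> IK [V IV dV] [W KW dW] hf Kf.
have VW : (V <= W)%VS by apply/subvP => g /IV/IK/KW.
have eVW : V == W by rewrite eqEdim VW -(leq_add2r h) dW dV /=.
by apply/(IV (DHomog hf)); rewrite (eqP eVW); apply/KW.
Qed.

(** Multiplication by the monomials of degree [e0] moves every homogeneous component into the range
    covered by the hypothesis, and saturation of [I] brings it back. *)
Lemma saturated_homog_sub I K e0 : is_scheme_ideal I -> is_scheme_ideal K ->
  (forall e f, (e0 <= e)%N -> f \is e.-homog -> K f -> I f) -> K `<=` I.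
Proof.
move=> [iI _ sI] [iK hK _] KI f Kf; apply: ideal_homog_components => // e.
apply: (sI _ e0) => b hb; apply: (KI (e0 + e)%N); first exact: leq_addr.
  by apply: dhomogM; [rewrite dhomogX /= hb | exact: pihomogP].
by have [_ _ KM] := iK; apply: KM; apply: hK.
Qed.

End Ideals.

(** * Sums of ideals, primes avoiding powers, and nilpotence from the support *)

Section IdealConstructions.
Variables (n : nat) (k : fieldType).
Local Notation R := {mpoly k[n.+1]}.
Implicit Types (I J P Q : set R) (f g u : R).

Definition ideal_add I J : set R :=
  [set h | exists f g, [/\ I f, J g & h = f + g]].

Definition principal_ideal f : set R := [set h | exists g, h = g * f].

Definition homog_core Q : set R := [set f | forall e, Q (pihomog mdeg e f)].

Lemma principal_ideal_ideal f : is_ideal (principal_ideal f).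
Proof.
split; first by exists 0; rewrite mul0r.
- by move=> _ _ [g1 ->] [g2 ->]; exists (g1 + g2); rewrite mulrDl.
- by move=> h _ [g ->]; exists (h * g); rewrite mulrA.
Qed.

Lemma ideal_addl I J : is_ideal J -> I `<=` ideal_add I J.
Proof. by move=> [J0 _ _] f If; exists f, 0; rewrite addr0. Qed.

Lemma ideal_addr I J : is_ideal I -> J `<=` ideal_add I J.
Proof. by move=> [I0 _ _] f Jf; exists 0, f; rewrite add0r. Qed.

Lemma ideal_add_ideal I J : is_ideal I -> is_ideal J -> is_ideal (ideal_add I J).
Proof.
move=> iI iJ; have [I0 ID IM] := iI; have [J0 JD JM] := iJ.
split; first by apply: ideal_addl.
- move=> _ _ [f1 [g1 [If1 Jg1 ->]]] [f2 [g2 [If2 Jg2 ->]]].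
  by exists (f1 + f2), (g1 + g2); split; [exact: ID | exact: JD | rewrite addrACA].
- move=> h _ [f [g [If Jg ->]]]; exists (h * f), (h * g).
  by split; [exact: IM | exact: JM | rewrite mulrDr].
Qed.

Lemma ideal_add_homog I J :
  is_homogeneous I -> is_homogeneous J -> is_homogeneous (ideal_add I J).
Proof.
move=> hI hJ _ [f [g [If Jg ->]]] e.
by exists (pihomog mdeg e f), (pihomog mdeg e g); rewrite pihomogD; split; auto.
Qed.

Lemma ideal_add_sub I J P :
  is_ideal P -> I `<=` P -> J `<=` P -> ideal_add I J `<=` P.
Proof. by move=> [_ PD _] IP JP _ [f [g [If Jg ->]]]; apply: PD; auto. Qed.

Lemma ideal_setI I J : is_ideal I -> is_ideal J -> is_ideal (I `&` J).
Proof.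
move=> [I0 ID IM] [J0 JD JM]; split=> //.
- by move=> f g [? ?] [? ?]; split; auto.
- by move=> f g [? ?]; split; auto.
Qed.

Lemma ideal_bigcup (F : set (set R)) (X0 : set R) :
  F X0 -> total_on F subset -> (forall X, F X -> is_ideal X) ->
  is_ideal (\bigcup_(X in F) X).
Proof.
move=> F0 tF iF; split.
- by exists X0 => //; have [] := iF _ F0.
- move=> f g [X FX Xf] [Y FY Yg].
  have [XY|YX] := tF X Y FX FY.
    by exists Y => //; have [_ YD _] := iF Y FY; apply: YD => //; apply: XY.
  by exists X => //; have [_ XD _] := iF X FX; apply: XD => //; apply: YX.
- by move=> f g [X FX Xg]; exists X => //; have [_ _ XM] := iF X FX; apply: XM.
Qed.

(** By Zorn's lemma there is a maximal ideal among those containing [I] and no power of [u];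
    maximality makes it prime. *)
Lemma prime_avoiding_powers I u : is_ideal I -> (forall m, ~ I (u ^+ m)) ->
  exists2 P, is_prime_ideal P & I `<=` P /\ ~ P u.
Proof.
move=> iI Iu.
pose avoid X := [/\ is_ideal X, I `<=` X & forall m, ~ X (u ^+ m)].
(* Zorn_bigcup also asks for an upper bound of the empty chain. *)
pose S : set (set R) := [set X | X = set0 \/ avoid X].
have [F FS tF|Q [SQ maxQ]] := @Zorn_bigcup _ S.
  have [[X0 FX0 aX0]|noX] := pselect (exists2 X, F X & avoid X); last first.
    left; apply/seteqP; split=> // f [X FX Xf].
    have [X0|aX] := FS X FX; first by rewrite -X0.
    by case: noX; exists X.
  (* Dropping a possible empty member of the chain leaves its union unchanged. *)
  right; pose F' := F `&` avoid.
  have -> : \bigcup_(X in F) X = \bigcup_(X in F') X.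
    apply/seteqP; split=> f [X FX Xf]; exists X => //; last by case: FX.
    by split=> //; have [Xe|//] := FS X FX; move: Xf; rewrite Xe.
  split.
  - apply: (ideal_bigcup (X0 := X0)) => //; last by move=> X [_ []].
    by move=> X Y [FX _] [FY _]; apply: tF.
  - by move=> f If; exists X0 => //; have [_ IX0 _] := aX0; apply: IX0.
  - by move=> m [X [_ [_ _ /(_ m)]]].
(* The maximal element is not the empty set, because [I] itself is a larger candidate. *)
have aQ : avoid Q.
  case: SQ => // Q0; case: (maxQ I); last by right; split.
  rewrite Q0; split=> // /(_ 0); apply; by have [] := iI.
have [iQ IQ Qu] := aQ; have [Q0 QD QM] := iQ.
have extend f : ~ Q f -> exists m, ideal_add Q (principal_ideal f) (u ^+ m).
  move=> nQf; apply: contrapT => /forallNP nu.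
  have iQf := ideal_add_ideal iQ (principal_ideal_ideal f).
  have QQf : Q `<=` ideal_add Q (principal_ideal f).
    by apply: ideal_addl; apply: principal_ideal_ideal.
  case: (maxQ (ideal_add Q (principal_ideal f))).
    split=> // QfQ; apply/nQf/QfQ/ideal_addr => //.
    by exists 1; rewrite mul1r.
  by right; split=> //; apply: subset_trans QQf.
exists Q; last by split=> //; apply: (Qu 1%N).
split=> //; first exact: (Qu 0%N).
move=> f g Qfg; apply: contrapT => /not_orP[/extend[a ua] /extend[b ub]].
(* If neither factor were in [Q], then u^a = p + h f and u^b = q + h' g with p, q in [Q]; as f g is
   in [Q], so would be u^(a + b). *)
case: ua => [p [_ [Qp [h ->] Eu]]]; case: ub => [q [_ [Qq [h' ->] Eu']]].
apply: (Qu (a + b)%N); rewrite exprD Eu Eu'.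
have -> : (p + h * f) * (q + h' * g) =
    (q + h' * g) * p + h * f * q + h * h' * (f * g).
  by ring.
by apply: (QD); [apply: QD|]; apply: QM.
Qed.

Lemma homog_core_homog Q : is_ideal Q -> is_homogeneous (homog_core Q).
Proof.
move=> [Q0 _ _] f Qf e e'; case: (eqVneq e e') => [<-|ne].
  by rewrite pihomog_id.
by rewrite (pihomog_ne0 ne) // pihomogP.
Qed.

Lemma homog_core_ideal Q : is_ideal Q -> is_ideal (homog_core Q).
Proof.
move=> iQ; have [Q0 QD QM] := iQ; split=> [e|f g Qf Qg e|f g Qg e].
- by rewrite pihomog0.
- by rewrite pihomogD; apply: QD.
- by rewrite pihomogM; apply: ideal_sum => // i _; apply: QM.
Qed.

Lemma homog_core_first Q f : ~ homog_core Q f ->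
  exists2 e, ~ Q (pihomog mdeg e f) & forall i, (i < e)%N -> Q (pihomog mdeg i f).
Proof.
move=> /existsNP[e0 h].
have ex : exists e, `[< ~ Q (pihomog mdeg e f) >] by exists e0; apply/asboolP.
case: (ex_minnP ex) => e /asboolP Qe mine; exists e => // i ie.
apply: contrapT => nQ; move: ie; rewrite ltnNge mine //.
exact/asboolP.
Qed.

(** Take the lowest components of f and g outside [Q], in degrees a and b. Every other term of the
    component of f g in degree a + b has a factor of lower index, hence lies in [Q], so the product
    of the two would lie in [Q] as well. *)
Lemma homog_core_prime Q : is_prime_ideal Q -> is_prime_ideal (homog_core Q).
Proof.
move=> [iQ Q1 QP]; have [_ _ QM] := iQ; split; first exact: homog_core_ideal.
  by move=> /(_ 0%N); rewrite pihomog_dE // dhomog1.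
move=> f g Qfg; apply: contrapT => /not_orP[/homog_core_first[a Qa lta]].
move=> /homog_core_first[b Qb ltb].
case: (QP (pihomog mdeg a f) (pihomog mdeg b g)) => //.
have lt : (a < (a + b).+1)%N by rewrite ltnS leq_addr.
have := Qfg (a + b)%N; rewrite pihomogM (bigD1 (Ordinal lt)) //= addKn.
apply: ideal_subl => //; apply: ideal_sum => // i; rewrite -val_eqE /= => ia.
case: (ltngtP i a) ia => // [ia|ia] _; first by apply: ideal_mulr => //; apply: lta.
apply/QM/ltb; rewrite ltn_subLR; last by rewrite -ltnS.
by rewrite ltn_add2r.
Qed.

(** Otherwise a prime contains [I] and avoids [u], and its homogeneous core is a point of the
    support that does not contain [u]. *)
Lemma nilpotent_of_support I u : is_ideal I -> is_homogeneous I ->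
  u \is 1.-homog -> (forall P, scheme_support I P -> P u) ->
  exists m, I (u ^+ m).
Proof.
move=> iI hI hu Pu; apply: contrapT => /forallNP Iu.
have [Q pQ [IQ Qu]] := prime_avoiding_powers iI Iu.
have [iQ _ _] := pQ.
have nu : ~ homog_core Q u by move=> /(_ 1%N); rewrite pihomog_dE.
apply: (nu); apply: Pu; split; last by move=> f If e; apply: IQ; apply: hI.
split; [exact: homog_core_prime | exact: homog_core_homog |].
(* The core lies in [Proj]: if it contained every variable, it would contain the linear form [u]. *)
apply: contrapT => /forallNP QX; apply: nu.
have [C0 CD CM] := homog_core_ideal iQ.
elim/homog_lin_ind: u / hu {Iu Qu} => //.
- by move=> c f; apply: ideal_scale; apply: homog_core_ideal.
- move=> b /eqP/mdeg1P[i /eqP ->]; apply: contrapT; exact: QX.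
Qed.

End IdealConstructions.

(** * Local schemes in coordinates centred at their point *)

Section LocalSchemes.
Variables (n : nat) (k : fieldType).
Local Notation R := {mpoly k[n.+1]}.
Implicit Types (I K D : set R) (f g : R) (v : 'I_n.+1 -> k) (s : seq 'I_n.+1).

Lemma point_ideal_homogP v e f : f \is e.-homog ->
  point_ideal v f <-> f.@[v] = 0.
Proof.
move=> hf; split=> [/(_ e)|f0 e']; first by rewrite pihomog_dE.
case: (eqVneq e e') => [<-|ne]; first by rewrite pihomog_dE.
by rewrite (pihomog_ne0 ne) // meval0.
Qed.

Lemma point_ideal_scale v c : c != 0 ->
  point_ideal (fun i => c * v i) = point_ideal v.
Proof.
move=> c0; have ev e f : f \is e.-homog ->
    f.@[fun i => c * v i] = c ^+ e * f.@[v].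
  elim/homog_lin_ind => [|f1 f2|a f1|b <-].
  - by rewrite !meval0 mulr0.
  - by rewrite !mevalD mulrDr => -> ->.
  - by rewrite !mevalZ mulrCA => ->.
  - rewrite !mevalX mdegE -prodrXr -big_split /=.
    by apply: eq_bigr => i _; rewrite exprMn.
apply/seteqP; split=> f h e; have := h e;
  rewrite (ev e) ?pihomogP //; last by move=> ->; rewrite mulr0.
by move/eqP; rewrite mulf_eq0 expf_eq0 (negbTE c0) andbF /= => /eqP.
Qed.

Lemma uform_homog v j i : uform v j i \is 1.-homog.
Proof. by rewrite rpredB ?dhomogXU // dhomogZ // dhomogXU. Qed.

Lemma point_ideal_uform v j i : v j = 1 -> point_ideal v (uform v j i).
Proof.
move=> vj; apply/(point_ideal_homogP _ (uform_homog v j i)).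
by rewrite mevalB mevalZ !mevalXU vj mulr1 subrr.
Qed.

Lemma point_idealX v i : v i != 0 -> ~ point_ideal v 'X_i.
Proof.
move=> vi /(point_ideal_homogP _ (dhomogXU _ i)).
by rewrite mevalXU; apply/eqP.
Qed.

Lemma prod_uform_homog v j s : \prod_(i <- s) uform v j i \is (size s).-homog.
Proof. by apply: dhomog_prodseq => i _; apply: uform_homog. Qed.

(** Replacing one variable at a time by y_i = u_i + v_i y_j rewrites every monomial in terms of the
    u_i and y_j. *)
Lemma homog_uform_ind v j (Q : R -> Prop) e :
  Q 0 -> (forall f g, Q f -> Q g -> Q (f + g)) ->
  (forall c f, Q f -> Q (c *: f)) ->
  (forall s c, (size s + c)%N = e ->
     Q ((\prod_(i <- s) uform v j i) * 'X_j ^+ c)) ->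
  forall f, f \is e.-homog -> Q f.
Proof.
move=> Q0 QD QZ Qu f; elim/homog_lin_ind=> // b.
suff H s c : (mdeg b + (size s + c))%N = e ->
    Q ('X_[b] * ((\prod_(i <- s) uform v j i) * 'X_j ^+ c)).
  move=> hb; have := H [::] 0%N; rewrite big_nil expr0 !mulr1; apply.
  by rewrite !addn0.
elim/mnm_rect: b s c => [|i b IH] s c.
  by rewrite mdeg0 mpolyX0 mul1r; apply: Qu.
rewrite mdegD mdeg1 => he.
have -> : 'X_[U_(i) + b] * (\prod_(l <- s) uform v j l * 'X_j ^+ c) =
    'X_[b] * (\prod_(l <- i :: s) uform v j l * 'X_j ^+ c) +
    v i *: ('X_[b] * (\prod_(l <- s) uform v j l * 'X_j ^+ c.+1)).
  by rewrite mpolyXD big_cons /uform -!mul_mpolyC exprS; ring.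
by apply: QD; [|apply: QZ]; apply: IH; rewrite /=; lia.
Qed.

Lemma prod_count (T : finType) (u : T -> R) (s : seq T) :
  \prod_(i <- s) u i = \prod_i u i ^+ count_mem i s.
Proof.
elim: s => [|x s IH]; first by rewrite big_nil big1.
rewrite big_cons IH /=; under [RHS]eq_bigr => i _ do rewrite exprD.
rewrite big_split /= [X in _ = X * _](bigD1 x) //= eqxx expr1.
by rewrite [X in _ = u x * X * _]big1 ?mulr1 // => i; rewrite eq_sym => /negbTE ->.
Qed.

Lemma size_count (T : finType) (s : seq T) : size s = (\sum_i count_mem i s)%N.
Proof.
elim: s => [|x s IH]; first by rewrite big1.
rewrite /= big_split /= -IH (bigD1 x) //= eqxx big1 // => i.
by rewrite eq_sym => /negbTE ->.
Qed.

Section AtPoint.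
Variables (v : 'I_n.+1 -> k) (j : 'I_n.+1).
Hypothesis vj : v j = 1.
Local Notation uprod s := (\prod_(i <- s) uform v j i).

(** Each u_i vanishes at the only point of the support, so some power [N i] of it is in [I]. A
    product longer than the sum of the [N i] repeats some u_i at least [N i] times. *)
Lemma uprod_nilpotent I : is_ideal I -> is_homogeneous I ->
  scheme_support I = [set point_ideal v] ->
  exists T, forall s, (T <= size s)%N -> I (uprod s).
Proof.
move=> iI hI sI.
have /choice[N IN] i : exists m, I (uform v j i ^+ m).
  apply: nilpotent_of_support => //; first exact: uform_homog.
  by move=> P; rewrite sI => ->; apply: point_ideal_uform.
exists (\sum_i N i).+1 => s hs.
have [/existsP[i Ni]|/existsPn lt] :=
    boolP [exists i, (N i <= count_mem i s)%N].
  rewrite prod_count (bigD1 i) //= -(subnK Ni) exprD -mulrA.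
  by have [_ _ IM] := iI; apply: IM; apply: ideal_mulr.
suff : (size s <= \sum_i N i)%N by rewrite leqNgt hs.
by rewrite size_count; apply: leq_sum => i _; apply: ltnW; rewrite ltnNge.
Qed.

(** The point lies off the hyperplane y_j = 0, so y_j is a nonzerodivisor modulo [I]. In degree
    [T + m], a product of u_i and y_j contains either y_j^m or at least [T] of the u_i; both
    multiply f into [I], and saturation applies. *)
Lemma Xpow_cancel I m f : is_scheme_ideal I ->
  scheme_support I = [set point_ideal v] -> I ('X_j ^+ m * f) -> I f.
Proof.
move=> [iI hI satI] sI If; have [T IT] := uprod_nilpotent iI hI sI.
have [I0 ID IM] := iI.
suff H g : g \is (T + m).-homog -> I (g * f).
  by apply: (satI _ (T + m)%N) => b hb; apply: H; rewrite dhomogX /= hb.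
move: g; apply: (@homog_uform_ind v j _ (T + m)%N) => [|g h|c g|s c hs].
- by rewrite mul0r.
- by rewrite mulrDl; apply: ID.
- by rewrite -scalerAl; apply: ideal_scale.
have [mc|cm] := leqP m c.
  by rewrite -(subnK mc) exprD mulrA -mulrA; apply: IM.
rewrite -mulrA; apply: ideal_mulr => //; apply: IT; lia.
Qed.

(* If a product of t uforms is not in I but all longer ones are, then its
   t+1 prefixes, padded with powers of X_j, are independent modulo I. *)
Lemma uprod_mem_length I r s : is_scheme_ideal I -> has_length I r ->
  scheme_support I = [set point_ideal v] -> (r <= size s)%N -> I (uprod s).
Proof.
move=> schI [e0 hr] sI; have [iI hI _] := schI; have [I0 ID IM] := iI.
have [T0 IT0] := uprod_nilpotent iI hI sI.
pose P T := `[< forall s, (T <= size s)%N -> I (uprod s) >].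
have exP : exists T, P T by exists T0; apply/asboolP.
case: (ex_minnP exP) => T /asboolP IT minT rs.
have [|ltrT] := leqP T r; first by move=> Tr; apply/IT/(leq_trans Tr).
case: T => // t in IT minT ltrT.
have [s1 [ts1 nIs1]] : exists s1, (t <= size s1)%N /\ ~ I (uprod s1).
  apply: contrapT => /forallNP h; suff: (t < t)%N by rewrite ltnn.
  apply: minT; apply/asboolP => s1 ts1; apply: contrapT => nI.
  by apply: (h s1).
have ss1 : size s1 = t.
  by apply/eqP; rewrite eqn_leq ts1 andbT leqNgt; apply/negP => /IT.
(* From [e0] on the Hilbert function equals [r]; being at least [t] keeps the exponents [e - i] from
   being truncated. *)
pose e := maxn e0 t.
pose w (i : 'I_t.+1) := uprod (take i s1) * 'X_j ^+ (e - i).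
have wh i : w i \is e.-homog.
  have it : (i <= t)%N by rewrite -ltnS.
  have -> : e = (i + (e - i))%N by rewrite subnKC // (leq_trans it) // leq_maxr.
  rewrite /w; apply: dhomogM.
    rewrite -[X in X.-homog](size_takel (s := s1) (n0 := i)) ?ss1 //.
    exact: prod_uform_homog.
  by have := dhomogMn (e - i) (dhomogXU k j); rewrite mul1n.
suff ind : forall c : 'I_t.+1 -> k, I (\sum_i c i *: w i) -> forall i, c i = 0.
  have := hilbert_indep_le (hr e (leq_maxl _ _)) I0 wh ind.
  by rewrite leqNgt ltrT.
move=> c Ic i; move: {2}(nat_of_ord i) (erefl (nat_of_ord i)) => m.
elim/ltn_ind: m i => m IH i im.
apply/eqP; apply: contraT => ci; case: nIs1.
(* Multiplying by the remaining factors turns the [i]-th term into a multiple of [uprod s1]. Terms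
   of larger index then have more than [t] factors and fall into [I]; those of smaller index vanish
   by induction. Cancelling y_j would put [uprod s1] in [I]. *)
have : I (uprod (drop i s1) * \sum_l c l *: w l) by apply: IM.
rewrite mulr_sumr (bigD1 i) //=.
have -> : uprod (drop i s1) * (c i *: w i) = c i *: ('X_j ^+ (e - i) * uprod s1).
  rewrite -scalerAr /w -[in RHS](cat_take_drop i s1) big_cat /=.
  by congr (_ *: _); ring.
move=> H; apply: (@Xpow_cancel _ (e - i)%N) => //.
rewrite -[_ * _]scale1r -(mulVf ci) -scalerA; apply: ideal_scale => //.
apply: (ideal_subl iI _ H); apply: ideal_sum => // l li.
case: (ltngtP l i) => [ltli|ltil|eqli].
- by rewrite (IH l) ?scale0r ?mulr0 // -im.
- rewrite -scalerAr; apply: ideal_scale => //.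
  rewrite /w mulrA -big_cat /=; apply: ideal_mulr => //; apply: IT.
  rewrite size_cat size_drop size_takel ?ss1; last by rewrite -ltnS.
  by have := ltn_ord i; lia.
- by move/negP: li; case; apply/eqP/val_inj.
Qed.

(** A product of u_i and y_j of degree [m + e] that is not divisible by y_j^m has more than [e]
    factors u_i, hence is in [D]. *)
Lemma Xpow_split D m e f : is_ideal D ->
  (forall s, (e < size s)%N -> D (uprod s)) -> f \is (m + e).-homog ->
  exists2 g, g \is e.-homog & D (f - 'X_j ^+ m * g).
Proof.
move=> iD Du; have [D0 DD DM] := iD.
move: f; apply: (@homog_uform_ind v j _ (m + e)%N) =>
  [|f1 f2 [g1 h1 D1] [g2 h2 D2]|c f [g hg Dg]|s c hs].
- by exists 0; rewrite ?dhomog0 // mulr0 subrr.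
- exists (g1 + g2); first exact: dhomogD.
  by rewrite mulrDr opprD addrACA; apply: DD.
- exists (c *: g); first exact: dhomogZ.
  by rewrite -scalerAr -scalerBr; apply: ideal_scale.
have [mc|cm] := leqP m c; last first.
  exists 0; rewrite ?dhomog0 // mulr0 subr0; apply: ideal_mulr => //.
  by apply: Du; lia.
exists (uprod s * 'X_j ^+ (c - m)).
  have -> : e = (size s + (c - m))%N by lia.
  apply: dhomogM; first exact: prod_uform_homog.
  by have := dhomogMn (c - m) (dhomogXU k j); rewrite mul1n.
by rewrite mulrCA -exprD subnKC // subrr.
Qed.

End AtPoint.
End LocalSchemes.

(** * Uniqueness of the minimal scheme at a given point *)

Section Uniqueness.
Variables (n : nat) (k : fieldType).
Local Notation R := {mpoly k[n.+1]}.
Implicit Types (I J K : set R) (f g : R) (v : 'I_n.+1 -> k).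

(** The colon ideal J : y_j^oo. It is the saturation with respect to the irrelevant ideal when [J]
    contains the ideal of a local scheme whose point lies off y_j = 0. *)
Definition Xpow_saturation j J : set R := [set f | exists m, J ('X_j ^+ m * f)].

Lemma Xpow_homog (j : 'I_n.+1) m : ('X_j ^+ m : R) \is m.-homog.
Proof. by have := dhomogMn m (dhomogXU k j); rewrite mul1n. Qed.

Lemma Xpow_saturation_sub j J : J `<=` Xpow_saturation j J.
Proof. by move=> f Jf; exists 0%N; rewrite mul1r. Qed.

Lemma Xpow_saturation_scheme j J :
  is_ideal J -> is_homogeneous J -> is_scheme_ideal (Xpow_saturation j J).
Proof.
move=> iJ hJ; have [J0 JD JM] := iJ; split.
- split; first by exists 0%N; rewrite mulr0.
  + move=> f g [a Jf] [b Jg]; exists (a + b)%N; rewrite mulrDr exprD.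
    by apply: JD; [rewrite mulrAC; apply: ideal_mulr | rewrite -mulrA; apply: JM].
  + by move=> f g [m Jg]; exists m; rewrite mulrCA; apply: JM.
- move=> f [m Jf] e; exists m.
  by rewrite -(pihomogMl e f (Xpow_homog j m)); apply: hJ.
- move=> f e h; have [|m] := h (U_(j) *+ e)%MM; first by rewrite mdegMn mdeg1 mul1n.
  by rewrite -mpolyXn mulrA -exprD => Jf; exists (m + e)%N.
Qed.

(** A prime above the saturation is above [I], hence is the point ideal; conversely the point ideal
    is a prime above [J] without y_j, so it absorbs the saturation. *)
Lemma Xpow_saturation_support j I J v : v j != 0 -> is_ideal J -> I `<=` J ->
  scheme_support I = [set point_ideal v] -> J `<=` point_ideal v ->
  scheme_support (Xpow_saturation j J) = [set point_ideal v].
Proof.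
move=> vj iJ IJ sI JP; have [PP _] : scheme_support I (point_ideal v) by rewrite sI.
have [pP _ _] := PP; have [iP P1 PM] := pP.
apply/seteqP; split=> [P [pP' KP]|_ ->].
  rewrite -sI; split=> //; apply: subset_trans IJ _.
  exact: subset_trans (@Xpow_saturation_sub j J) KP.
split=> // f [m /JP/PM[|//]] /(prime_exp pP) /point_idealX.
by move/(_ vj).
Qed.

(** Multiplication by y_j is injective modulo the saturation, so it preserves independent
    families. *)
Lemma Xpow_saturation_hilbert_mono j J e h h' : is_ideal J -> is_homogeneous J ->
  hilbert_function_at (Xpow_saturation j J) e h ->
  hilbert_function_at (Xpow_saturation j J) e.+1 h' -> (h <= h')%N.
Proof.
move=> iJ hJ hK hK'; have [[K0 _ _] _ _] := Xpow_saturation_scheme j iJ hJ.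
have [w ww ind] := hilbert_indep_ex hK.
apply: (hilbert_indep_le (w := fun i => 'X_j * w i) hK' K0) => [i|c [m Jc]].
  by rewrite -[e.+1]/(1 + e)%N; apply: dhomogM; first exact: dhomogXU.
apply: ind; exists m.+1; rewrite exprSr -mulrA mulr_sumr.
by under eq_bigr => i _ do rewrite -scalerAr.
Qed.

Lemma bounded_mono_eventually_const (h : nat -> nat) e0 r :
  (forall e, (e0 <= e)%N -> (h e <= h e.+1)%N) ->
  (forall e, (e0 <= e)%N -> (h e <= r)%N) ->
  exists2 s, (s <= r)%N & exists e1, forall e, (e1 <= e)%N -> h e = s.
Proof.
move=> mono bnd.
pose P m := `[< exists2 e, (e0 <= e)%N & h e = m >].
have exP : exists m, P m by exists (h e0); apply/asboolP; exists e0.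
have leP m : P m -> (m <= r)%N by move=> /asboolP[e /bnd + <-].
case: (ex_maxnP exP leP) => s Ps maxs; exists s; first exact: leP.
move: Ps => /asboolP[e1 le1 he1]; exists e1; elim=> [|e IH].
  by rewrite leqn0 => /eqP e10; rewrite -e10.
rewrite leq_eqVlt => /orP[/eqP <- //|]; rewrite ltnS => le.
have le0 : (e0 <= e)%N by apply: leq_trans le.
apply/eqP; rewrite eqn_leq -{2}(IH le) mono // andbT.
by apply: maxs; apply/asboolP; exists e.+1 => //; apply: leqW.
Qed.

(** The Hilbert function of the saturation is nondecreasing and, in large degrees, bounded by that
    of [I], which is [r]; hence it is eventually constant. *)
Lemma Xpow_saturation_length j I J r : is_ideal J -> is_homogeneous J ->
  I `<=` J -> has_length I r ->
  exists2 s, (s <= r)%N & has_length (Xpow_saturation j J) s.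
Proof.
move=> iJ hJ IJ [e0 Ir].
have [iK _ _] := Xpow_saturation_scheme j iJ hJ.
have /choice[h hK] e := hilbert_exists e iK.
have [||s sr [e1 he1]] := @bounded_mono_eventually_const h e0 r.
- by move=> e _; apply: Xpow_saturation_hilbert_mono (hK _) (hK _).
- move=> e /Ir hI; apply: hilbert_le hI (hK e).
  exact: subset_trans (@Xpow_saturation_sub j J).
by exists s => //; exists e1 => e /he1 <-.
Qed.

(** If g in [K] has degree e <= d, all its multiples of degree d annihilate [F]. So all derivatives
    of order d - e of the form [apply_diff g F], which has that degree, vanish, and the form is 0 by
    the bound on the characteristic. *)
Lemma apolar_of_degree d (F : R) K :
  (forall p, p \in [pchar k] -> (d < p)%N) -> F \is d.-homog ->
  is_ideal K -> is_homogeneous K ->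
  (forall g, g \is d.-homog -> K g -> Ann F g) -> is_apolar F K.
Proof.
move=> hp hF iK hK Kd g Kg; apply: (ideal_homog_components (Ann_ideal F)) => e.
have {Kg} := hK g Kg e; have hg := pihomogP mdeg e g.
move: {g}(pihomog _ _ _) hg => g hg Kg; rewrite /Ann /=.
have [ltde|led] := ltnP d e; first exact: apply_diff_homog_gt ltde hF hg.
apply: (homog_mderivm_eq0 hp (leq_subr e d)) => [|b hb].
  by apply: apply_diff_homog hg; rewrite subnKC.
rewrite -apply_diffX -apply_diffM; apply: Kd.
  by rewrite -(subnK led); apply: dhomogM; rewrite // dhomogX /= hb.
by have [_ _ KM] := iK; apply: KM.
Qed.

Lemma minimal_apolar_unique d r (F : R) I I' v j :
  (forall p, p \in [pchar k] -> (d < p)%N) -> F \is d.-homog -> (r <= d)%N ->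
  (forall K s, local_apolar_of_length F K s -> (r <= s)%N) ->
  v j = 1 ->
  local_apolar_of_length F I r -> scheme_support I = [set point_ideal v] ->
  local_apolar_of_length F I' r -> scheme_support I' = [set point_ideal v] ->
  I = I'.
Proof.
move=> hp hF rd minr vj [[schI lI ratI _] aI] sI [[schI' lI' _ _] aI'] sI'.
have [iI hI _] := schI; have [iI' hI' _] := schI'.
pose J := ideal_add I I'; pose K := Xpow_saturation j J.
have iJ : is_ideal J by apply: ideal_add_ideal.
have hJ : is_homogeneous J by apply: ideal_add_homog.
have IJ : I `<=` J by apply: ideal_addl.
have I'J : I' `<=` J by apply: ideal_addr.
have schK : is_scheme_ideal K by apply: Xpow_saturation_scheme.
have [iK hK _] := schK.
have [s sr lK] := Xpow_saturation_length j iJ hJ IJ lI.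
have vj0 : v j != 0 by rewrite vj oner_neq0.
have [[pP _ _] IP] : scheme_support I (point_ideal v) by rewrite sI.
have [_ I'P] : scheme_support I' (point_ideal v) by rewrite sI'.
have JP : J `<=` point_ideal v by apply: ideal_add_sub => //; case: pP.
have sK : scheme_support K = [set point_ideal v].
  exact: (Xpow_saturation_support vj0 iJ IJ sI JP).
have aK : is_apolar F K.
  apply: (apolar_of_degree hp hF) => // g hg [m [a [a' [Ia Ia' Eg]]]].
  (* Here y_j^m g = a + a' with a in [I] and a' in [I'], both taken in degree [m + d]. Modulo the
     intersection of [I] and [I'] they become y_j^m b and y_j^m b'; cancelling y_j^m puts b in [I],
     b' in [I'] and g - b - b' in [I]. *)
  have {}Eg : 'X_j ^+ m * g = pihomog mdeg (m + d) a + pihomog mdeg (m + d) a'.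
    by rewrite -pihomogD -Eg (pihomogMl _ _ (Xpow_homog j m)) pihomog_dE.
  have {}Ia := hI a Ia (m + d)%N; have {}Ia' := hI' a' Ia' (m + d)%N.
  have iD := ideal_setI iI iI'.
  have uD (t : seq 'I_n.+1) : (d < size t)%N ->
      (I `&` I') (\prod_(i <- t) uform v j i).
    move=> dt; have rt : (r <= size t)%N by apply: leq_trans rd (ltnW dt).
    split; first exact: (uprod_mem_length vj schI lI sI).
    exact: (uprod_mem_length vj schI' lI' sI').
  have [b hb [Ib I'b]] := Xpow_split iD uD (pihomogP mdeg (m + d) a).
  have [b' hb' [Ib' I'b']] := Xpow_split iD uD (pihomogP mdeg (m + d) a').
  have {}Ib0 : I b.
    apply: (Xpow_cancel vj schI sI (m := m)).
    by rewrite -(subKr (pihomog mdeg (m + d) a) (_ * b)); apply: ideal_sub.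
  have {}Ib'0 : I' b'.
    apply: (Xpow_cancel vj schI' sI' (m := m)).
    by rewrite -(subKr (pihomog mdeg (m + d) a') (_ * b')); apply: ideal_sub.
  have Ig : I (g - b - b').
    apply: (Xpow_cancel vj schI sI (m := m)).
    rewrite !mulrBr Eg -[_ - _ - _]addrA addrACA.
    by have [_ ID _] := iI; apply: ID.
  have [A0 AD _] := Ann_ideal F.
  have -> : g = (g - b - b') + b + b' by rewrite addrAC subrK subrK.
  by apply: (AD); [apply: AD; apply: aI | apply: aI'].
(* [K] now defines a local scheme apolar to [F], so minimality bounds its length from below. *)
have rs : (r <= s)%N.
  apply: (minr K); split=> //; split=> //; last by exists (point_ideal v).
  by move=> P; rewrite sK -sI; apply: ratI.
have {s lK sr rs} lK : has_length K r.
  by have /eqP <- : s == r by rewrite eqn_leq sr rs.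
have IK : I `<=` K := subset_trans IJ (@Xpow_saturation_sub j J).
have I'K : I' `<=` K := subset_trans I'J (@Xpow_saturation_sub j J).
(* Inclusion and equal lengths give equality in all large degrees, and saturation extends it to
   every degree. *)
have eqK I0 : is_scheme_ideal I0 -> has_length I0 r -> I0 `<=` K -> I0 = K.
  move=> sch0 [e0 l0] I0K; have [e1 l1] := lK.
  apply/seteqP; split=> //.
  apply: (saturated_homog_sub (e0 := maxn e0 e1)) => // e f.
  rewrite geq_max => /andP[/l0 h0 /l1 h1]; exact: hilbert_eq_mem I0K h0 h1.
by rewrite (eqK I) // (eqK I').
Qed.

Lemma local_support_normalised I r : local_scheme_of_length I r ->
  exists v j, v j = 1 /\ scheme_support I = [set point_ideal v].
Proof.
move=> [_ _ rat [P sP]].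
have [v [j vj] PE] : exists2 v : 'I_n.+1 -> k,
    (exists i, v i != 0) & P = point_ideal v.
  by apply: rat; rewrite sP.
exists (fun i => (v j)^-1 * v i), j; split; first by rewrite mulVf.
by rewrite point_ideal_scale ?invr_eq0 // -PE.
Qed.

End Uniqueness.

(** * Counting the points *)

Lemma card_le_II_of_inj (T : pointedType) (A : set T) d :
  (forall f : nat -> T, (forall a, (a <= d)%N -> A (f a)) ->
     {in [pred a | a <= d]%N &, injective f} -> False) -> A #<= `I_d.
Proof.
move=> H; suff /contrapT nle : ~ ~ (A #<= `I_d) by [].
move=> nle; have : `I_d.+1 #<= A.
  have [/finite_setP[m Am]|/infiniteP inf] := pselect (finite_set A).
    rewrite (card_le_eqr Am) card_le_II ltnNge; apply/negP => md.
    by apply: nle; rewrite (card_le_eql Am) card_le_II.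
  apply: card_le_trans inf; exact: subset_card_le.
move=> /pcard_leP[f]; apply: (H f) => [a ad|a b].
  by apply: (@funS _ _ _ _ f).
by rewrite !inE => ad bd; apply: inj; rewrite inE.
Qed.

Theorem corollary3p7 (n d : nat) (k : fieldType) (F : {mpoly k[n.+1]}) :
  (1 <= n)%N ->
  (forall p, p \in [pchar k] -> (d < p)%N) ->
  F \is d.-homog ->
  F != 0 ->
  (exists2 r, is_local_cactus_rank F r & (r <= d)%N) ->
  minimal_local_apolar F #<= `I_(d ^ n).
Proof.
move=> n1 hp hF F0 [r [exr minr] rd].
(* The bound d is proved; it implies the bound d^n because n >= 1. *)
apply: (@card_le_trans _ _ _ `I_d); last first.
  rewrite card_le_II; case: (d) => [|d'] //.
  by rewrite -{1}(expn1 d'.+1) leq_pexp2l.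
apply: card_le_II_of_inj => I SI injI.
have lI a : (a <= d)%N -> local_apolar_of_length F (I a) r.
  move=> /SI[s [exs mins] lIs]; have /eqP <- // : s == r.
  have [[K lK] [K' lK']] := (exs, exr).
  by rewrite eqn_leq (mins _ _ lK') (minr _ _ lK).
(* Suppose there are d + 1 distinct minimal schemes, indexed from 0 to d. Indices above d receive an
   arbitrary default point. *)
have /choice[vj vjP] (a : nat) : exists vj : ('I_n.+1 -> k) * 'I_n.+1, (a <= d)%N ->
    vj.1 vj.2 = 1 /\ scheme_support (I a) = [set point_ideal vj.1].
  have [/lI[/local_support_normalised[v [j h]] _]|] := leqP a d;
    last by exists (fun=> 0, ord0).
  by exists (v, j).
(* The d + 1 points would give d + 1 linear factors, while a nonzero form of degree d has size d +
   1. *)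
have : (d.+1 < msize F)%N.
  apply: (@num_linear_factors _ _ (fun a => (vj a).1) (fun a => (vj a).2)) => //.
  - by move=> a /vjP[].
  - move=> a b /andP[ab bd]; have ad := ltn_trans ab bd.
    have [[va sa] [vb sb]] := (vjP a ad, vjP b bd).
    apply/eqP => /lform_hyp_proj_eq0 vE.
    (* Proportional vectors define the same point, where the minimal scheme is unique; this
       contradicts the distinctness of the schemes. *)
    suff eqI : I a = I b by move: ab; rewrite (injI _ _ _ _ eqI) ?inE // ltnn.
    apply: (minimal_apolar_unique hp hF rd minr va (lI a ad) sa (lI b bd)).
    rewrite sb vE point_ideal_scale //; apply: contraTneq (oner_neq0 k) => c0.
    by rewrite -vb vE c0 mul0r eqxx.
  - move=> a ad; have [va sa] := vjP a ad.
    have [[schI lenI _ _] aI] := lI a ad.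
    apply: (hyp_proj_eq0 hp hF) => s hs; apply: aI.
    by apply: (uprod_mem_length va schI lenI sa); rewrite hs.
rewrite ltnNge; case/negP; rewrite -ltnS.
have := dhomog_uniq F0 hF (dhomog_msize hF) => /= ->.
by rewrite prednK // lt0n msize_poly_eq0.
Qed.
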